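(* Let $0\le k\le d$ and let $K$ be a compact subset of the metric space of manifold functions $(X_k,d_{X_k})$. Let $0\le s\le r$, and suppose that $\{\phi_{n,m}\}_{1\le n,\,1\le m\le\kappa(n)}$ is an $(r,s,t)$-convergence sequence, with induced encoders $\{\Phi_n\}$ and decoders $\{\Psi_n^{r,s}\}$. Let $P_n^{r,s}:=\Psi_n^{r,s}\circ\Phi_n$ be the reconstruction mapping and let $I$ be the identity mapping (embedding) of $K$ into $(C^r(V))'\times(C^r(V))'$. Then $$\left\lVert P_n^{r,s}-I\right\rVert_{C(K,(C^r(V))'\times(C^r(V))')}=\sup_{(M,f_M)\in K}\left\lVert P_n^{r,s}(M,f_M)-(M,f_M)\right\rVert_{(C^r(V))'\times(C^r(V))'}=\mathcal{O}\left(\frac{1}{n^{t}}\right)\quad (n\to\infty).$$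
   Context: **Domain and function spaces.** $V:=[0,1]^d$. $C(V)$ is the space of continuous real functions with the sup norm, $C^r(V)$ ($r$ a nonnegative integer) the usual space of $r$ times continuously differentiable functions with its usual norm, $H^s(V)$ ($s\ge 0$) the usual Hilbert Sobolev space. A prime denotes the dual Banach space with operator norm. A product of two dual spaces carries the sum norm $\lVert(f_1,f_2)\rVert=\lVert f_1\rVert+\lVert f_2\rVert$. **Manifold functions.** $\mathcal{H}^k$ is the $k$-dimensional Hausdorff measure. Let $\mathcal{M}_k$ be the set of all finite unions $\cup_{i=1}^m M_i$, $m\ge1$, where each $M_i\subset V$ is a compact $k$-dimensional Lipschitz manifold (possibly with boundary) with $\mathcal{H}^k(M_i)<\infty$, and for $i\ne j$ the intersection $M_i\cap M_j$ is a manifold of dimension less than $k$ or empty. For $k=0$, elements of $\mathcal{M}_0$ are finite sets of points of $V$. Set $X_k:=\{(M,f_M):M\in\mathcal{M}_k,\ f_M\in L^2(M)\}$, with $L^2(M)$ taken with respect to $\mathcal{H}^k$ (for $k=0$, $f_M$ is a real function on the points). For $(M,f_M)\in X_k$, view $M$ and $f_M$ as bounded linear functionals on $C(V)$: $\langle M,\phi\rangle:=\int_M\phi\,d\mathcal{H}^k$ and $\langle f_M,\phi\rangle:=\int_M f_M\phi\,d\mathcal{H}^k$. This embeds $X_k$ into $(C(V))'\times(C(V))'$, and $X_k$ carries the induced metric $$d_{X_k}((M_1,f^1_{M_1}),(M_2,f^2_{M_2})):=\lVert M_1-M_2\rVert_{(C(V))'}+\lVert f^1_{M_1}-f^2_{M_2}\rVert_{(C(V))'}.$$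 By restricting functionals to $C^r(V)$, elements of $(C(V))'\times(C(V))'$, in particular of $X_k$, are regarded as elements of $(C^r(V))'\times(C^r(V))'$. **$(r,s,t)$-convergence sequence.** Let $\kappa$ be a monotonically increasing function from positive integers to positive integers. $\{\phi_{n,m}\}_{1\le n,1\le m\le\kappa(n)}$ is an $(r,s,t)$-convergence sequence if $\phi_{n,m}\in C(V)\cap H^s(V)$, for each $n$ the functions $\phi_{n,1},\dots,\phi_{n,\kappa(n)}$ are linearly independent, and $$\sup_{\lVert\phi\rVert_{C^r(V)}\le1}\lVert\phi-\Pi_n^s\phi\rVert_{C(V)}=\mathcal{O}\left(\frac1{n^t}\right),\qquad \Pi_n^s\phi:=\operatorname*{arg\,min}_{v\in\operatorname{span}\{\phi_{n,m}\}_{m=1}^{\kappa(n)}}\lVert\phi-v\rVert_{H^s(V)},$$ i.e. $\Pi_n^s$ is the $H^s$-orthogonal projection onto $\operatorname{span}\{\phi_{n,m}\}_{m=1}^{\kappa(n)}$. **Encoder and decoder.** The encoder is $\Phi_n:(C(V))'\times(C(V))'\to\mathbb{R}^{2\kappa(n)}$, $\Phi_n(f_1,f_2):=\left((\langle f_1,\phi_{n,m}\rangle)_{m=1}^{\kappa(n)},(\langle f_2,\phi_{n,m}\rangle)_{m=1}^{\kappa(n)}\right)$. For $0\le s\le r$, the decoder is $\Psi_n^{r,s}:\mathbb{R}^{2\kappa(n)}\to(C^r(V))'\times(C^r(V))'$, $$\Psi_n^{r,s}\left((\alpha_m)_{m=1}^{\kappa(n)},(\beta_m)_{m=1}^{\kappa(n)}\right):=\left(\sum_{m=1}^{\kappa(n)}\alpha_m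 e_{n,m}^*,\ \sum_{m=1}^{\kappa(n)}\beta_m e_{n,m}^*\right),$$ where $e_{n,m}^*\in(C^r(V))'$ is $\langle e_{n,m}^*,\cdot\rangle:=\langle\phi_{n,m}^*,\Pi_n^s(\cdot)\rangle$ and $\{\phi_{n,m}^*\}_{m=1}^{\kappa(n)}$ is the dual basis of $\{\phi_{n,m}\}_{m=1}^{\kappa(n)}$ on the finite-dimensional space $\operatorname{span}\{\phi_{n,m}\}_{m=1}^{\kappa(n)}$. *)

(* Defs.v *)
From HB Require Import structures.
From mathcomp Require Import all_boot all_order all_algebra.
From mathcomp Require Import all_classical all_reals all_analysis.

Set Implicit Arguments.
Unset Strict Implicit.
Unset Printing Implicit Defensive.

Import Order.TTheory GRing.Theory Num.Theory.
Import numFieldNormedType.Exports.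

Local Open Scope classical_set_scope.
Local Open Scope ring_scope.
Local Open Scope ereal_scope.

(* Conventions. A function on [0,1]^d is represented by a function on
   'rV[R]_d, of which only the values on the cube are ever used. The library
   norm on 'rV[R]_d is the max norm; it is used only for its topology, all
   metric notions being defined through [enorm]. Norms of functions and of
   functionals are extended reals, so that no finiteness is built in. *)

Section outer_measures.
Context (R : realType).

Section cover_outer_measure.
Context (T : Type) (g : set T -> \bar R).

Definition cover_outer (A : set T) : \bar R :=
  ereal_inf [set \sum_(n <oo) g (F n) |
    F in [set F : (set T)^nat | A `<=` \bigcup_n F n]].

Hypotheses (g0 : g set0 = 0) (g_ge0 : forall F, 0 <= g F).

Lemma cover_outer_ge0 A : 0 <= cover_outer A.
Proof.
by apply: le_ereal_inf_tmp => _ [F _ <-]; exact: nneseries_ge0.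
Qed.

Lemma cover_outer0 : cover_outer set0 = 0.
Proof.
apply/eqP; rewrite eq_le cover_outer_ge0 andbT.
apply: ereal_inf_lbound; exists (fun=> set0); first by [].
by rewrite eseries0.
Qed.

Lemma le_cover_outer : {homo cover_outer : A B / A `<=` B >-> A <= B}.
Proof.
move=> A B AB; apply/ereal_inf_le_tmp => x [F BF <-].
by exists F => //; exact: subset_trans BF.
Qed.

Lemma cover_outer_sigma_subadditive : sigma_subadditive cover_outer.
Proof.
move=> A; have [[i ioo]|] := pselect (exists i, cover_outer (A i) = +oo).
  rewrite (eseries_pinfty _ _ ioo) ?leey// => n _.
  by rewrite -ltNye (lt_le_trans _ (cover_outer_ge0 _)).
rewrite -forallNE => Aoo.
apply/lee_addgt0Pr => e e0.
rewrite (le_trans _ (epsilon_trick _ _ (ltW e0)))//; last first.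
  by move=> n; exact: cover_outer_ge0.
pose P n (B : (set T)^nat) := A n `<=` \bigcup_k B k /\
  \sum_(k <oo) g (B k) <= cover_outer (A n) + (e / (2 ^ n.+1)%:R)%:E.
have [G PG] : {G : ((set T)^nat)^nat & forall n, P n (G n)}.
  apply: (@choice _ _ P) => n.
  have en1 : (0 < e / (2 ^ n.+1)%:R)%R.
    by rewrite divr_gt0// ltr0n expn_gt0.
  have Afin : cover_outer (A n) \is a fin_num.
    by rewrite ge0_fin_numE ?cover_outer_ge0// ltey; apply/eqP; exact: Aoo.
  have [x [B AnB muBx] xS] := lb_ereal_inf_adherent en1 Afin.
  by exists B; split => //; rewrite muBx; exact: ltW.
have gG_ge0 x : 0 <= (g \o uncurry G) x by exact: g_ge0.
apply: (@le_trans _ _ (\esum_(i in setT) (g \o uncurry G) i)).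
  apply: ereal_inf_lbound => /=.
  have /card_esym/ppcard_eqP[f] := card_nat2.
  exists (uncurry G \o f).
    apply: (@subset_trans _ (\bigcup_n \bigcup_k G n k)) => [t [i _]|].
      by move=> /(PG i).1 -[j _ ?]; exists i => //; exists j.
    move=> t [i _ [j _ Bijt]]; exists (f^-1%FUN (i, j)) => //=.
    by rewrite invK ?inE.
  rewrite -(esum_pred_image (g \o uncurry G) _ xpredT) ?[fun=> _]set_true//.
  by rewrite image_eq.
rewrite (_ : esum _ _ = \sum_(i <oo) \sum_(j <oo ) g (G i j)); last first.
  pose J : nat -> set (nat * nat) := fun i => [set (i, j) | j in setT].
  rewrite (_ : setT = \bigcup_k J k); last first.
    by rewrite predeqE => -[a b]; split => // _; exists a => //; exists b.
  rewrite esum_bigcupT /=; last 2 first.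
    - apply/trivIsetP => i j _ _ ij.
      rewrite predeqE => -[n m] /=; split => //= -[] [_] _ [<-{n} _].
      by move=> [m' _] [] /esym/eqP; rewrite (negbTE ij).
    - by move=> /= [n m]; exact: g_ge0.
  rewrite -(image_id [set: nat]) -fun_true esum_pred_image//; last first.
    by move=> n _; exact: esum_ge0.
  apply: eq_eseriesr => /= j _.
  rewrite -(esum_pred_image (g \o uncurry G) (pair j) predT)//=; last first.
    by move=> ? ? _ _; exact: (@can_inj _ _ _ snd).
  by congr esum; rewrite predeqE => -[a b]; split; move=> [i _ <-]; exists i.
apply: lee_lim.
- apply: is_cvg_nneseries => n *.
  by apply: nneseries_ge0 => m *; exact: (gG_ge0 (n, m)).
- by apply: is_cvg_nneseries => n *; apply: adde_ge0 => //;
    [exact: cover_outer_ge0|rewrite lee_fin divr_ge0// ltW].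
- by near=> n; apply: lee_sum => i _; exact: (PG i).2.
Unshelve. all: by end_near. Qed.

End cover_outer_measure.

Definition enorm n (x : 'rV[R]_n) : R :=
  Num.sqrt (\sum_(i < n) x ord0 i ^+ 2)%R.

Definition diam n (F : set 'rV[R]_n) : \bar R :=
  ereal_sup [set e | exists x y, [/\ F x, F y & e = (enorm (x - y))%:E]].

(* Volume pi^(k/2) / Gamma(k/2 + 1) of the unit ball of R^k. *)
Fixpoint unit_ball_vol (k : nat) : R :=
  match k with
  | 0 => 1
  | 1 => 2
  | k'.+2 => (2 * pi / k%:R * unit_ball_vol k')%R
  end.

(* Sets of diameter greater than delta get weight +oo, which excludes them
   from coverings. For k = 0 every nonempty set has weight 1. *)
Definition hausdorff_gauge n (k : nat) (delta : R) (F : set 'rV[R]_n) : \bar R :=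
  if F == set0 then 0
  else if diam F <= delta%:E
    then (unit_ball_vol k / 2 ^+ k)%:E * diam F ^+ k
    else +oo.

Definition hausdorff n (k : nat) (A : set 'rV[R]_n) : \bar R :=
  ereal_sup [set cover_outer (hausdorff_gauge k delta) A |
    delta in [set delta : R | (0 < delta)%R]].

Definition box n (a b : 'rV[R]_n) : set 'rV[R]_n :=
  [set x | forall i, (a ord0 i <= x ord0 i <= b ord0 i)%R].

Definition box_gauge n (F : set 'rV[R]_n) : \bar R :=
  if F == set0 then 0
  else ereal_inf [set (\prod_(i < n) (ab.2 ord0 i - ab.1 ord0 i))%:E |
    ab in [set ab : 'rV[R]_n * 'rV[R]_n | F `<=` box ab.1 ab.2]].

Definition lebesgue n : set 'rV[R]_n -> \bar R := cover_outer (@box_gauge n).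

Lemma diam_ge0 n (F : set 'rV[R]_n) : F != set0 -> 0 <= diam F.
Proof.
move=> /set0P[x Fx]; apply: le_trans (ereal_sup_ubound _); last by exists x, x; split.
by rewrite lee_fin sqrtr_ge0.
Qed.

Lemma unit_ball_vol_ge0 k : (0 <= unit_ball_vol k)%R.
Proof.
suff : (0 <= unit_ball_vol k)%R /\ (0 <= unit_ball_vol k.+1)%R by case.
elim: k => [|k [IH1 IH2]]; split => //=.
by rewrite mulr_ge0// divr_ge0// mulr_ge0// pi_ge0.
Qed.

Lemma hausdorff_gauge_ge0 n k delta (F : set 'rV[R]_n) :
  0 <= hausdorff_gauge k delta F.
Proof.
rewrite /hausdorff_gauge; case: ifPn => // F0; case: ifPn => // _.
by rewrite mule_ge0 ?expe_ge0 ?diam_ge0// lee_fin divr_ge0 ?unit_ball_vol_ge0.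
Qed.

Lemma hausdorff_gauge0 n k delta : hausdorff_gauge k delta (set0 : set 'rV[R]_n) = 0.
Proof. by rewrite /hausdorff_gauge eqxx. Qed.

Lemma box_gauge_ge0 n (F : set 'rV[R]_n) : 0 <= box_gauge F.
Proof.
rewrite /box_gauge; case: ifPn => // /set0P[x Fx].
apply: le_ereal_inf_tmp => _ [[a b] /= Fab <-]; rewrite lee_fin.
apply: prodr_ge0 => i _; rewrite subr_ge0.
by have /andP[] := Fab x Fx i; exact: le_trans.
Qed.

Lemma box_gauge0 n : box_gauge (set0 : set 'rV[R]_n) = 0.
Proof. by rewrite /box_gauge eqxx. Qed.

Lemma hausdorff0 n k : hausdorff k (set0 : set 'rV[R]_n) = 0.
Proof.
apply/eqP; rewrite eq_le; apply/andP; split.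
  apply: ge_ereal_sup => _ [e _ <-]; rewrite cover_outer0//.
    exact: hausdorff_gauge0.
  by move=> F; exact: hausdorff_gauge_ge0.
apply: (le_trans _ (ereal_sup_ubound _)); last by exists 1%R => //=.
by apply: cover_outer_ge0 => F; exact: hausdorff_gauge_ge0.
Qed.

Lemma hausdorff_ge0 n k (A : set 'rV[R]_n) : 0 <= hausdorff k A.
Proof.
apply: (le_trans _ (ereal_sup_ubound _)); last by exists 1%R => //=.
by apply: cover_outer_ge0 => F; exact: hausdorff_gauge_ge0.
Qed.

Lemma le_hausdorff n k :
  {homo (@hausdorff n k) : A B / A `<=` B >-> A <= B}.
Proof.
move=> A B AB; apply: ge_ereal_sup => _ [e e0 <-].
apply: (le_trans _ (ereal_sup_ubound _)); last by exists e.
exact: le_cover_outer.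
Qed.

Lemma hausdorff_sigma_subadditive n k : sigma_subadditive (@hausdorff n k).
Proof.
move=> F; apply: ge_ereal_sup => _ [e e0 <-].
have g0 : forall G : set 'rV[R]_n, 0 <= hausdorff_gauge k e G.
  exact: hausdorff_gauge_ge0.
have := cover_outer_sigma_subadditive g0 F.
move/le_trans; apply.
apply: lee_nneseries => [i _ _|i _]; first exact: cover_outer_ge0.
by apply: ereal_sup_ubound; exists e.
Qed.

HB.instance Definition _ n k := isOuterMeasure.Build R 'rV[R]_n (@hausdorff n k)
  (hausdorff0 n k) (@hausdorff_ge0 n k) (@le_hausdorff n k)
  (@hausdorff_sigma_subadditive n k).

HB.instance Definition _ n := isOuterMeasure.Build R 'rV[R]_n (@lebesgue n)
  (cover_outer0 (box_gauge0 n) (@box_gauge_ge0 n))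
  (cover_outer_ge0 (@box_gauge_ge0 n))
  (@le_cover_outer _ (@box_gauge n))
  (cover_outer_sigma_subadditive (@box_gauge_ge0 n)).

(* Measurability and integrals with respect to an outer measure refer to its
   Caratheodory sigma-algebra. *)
Definition cara n (mu : {outer_measure set 'rV[R]_n -> \bar R}) :
    {measure set (caratheodory_type mu) -> \bar R} :=
  (mu : set (caratheodory_type mu) -> \bar R).

Definition L2 n (mu : {outer_measure set 'rV[R]_n -> \bar R})
    (D : set 'rV[R]_n) (f : 'rV[R]_n -> R) : Prop :=
  measurable_fun (D : set (caratheodory_type mu))
    (f : caratheodory_type mu -> R) /\
  \int[cara mu]_(x in D) ((f x) ^+ 2)%:E < +oo.

Definition integral_over n (mu : {outer_measure set 'rV[R]_n -> \bar R})
    (D : set 'rV[R]_n) (f : 'rV[R]_n -> R) : R :=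
  (\int[cara mu]_(x in D) f x)%R.

End outer_measures.

Arguments hausdorff {R n} k A.
Arguments lebesgue {R n} A.

Section function_spaces.
Context {R : realType} {d : nat}.
Local Notation pt := 'rV[R]_d.
Local Notation fn := (pt -> R).

Definition cube : set pt := [set x | forall i, (0 <= x ord0 i <= 1)%R].

Definition open_cube : set pt := [set x | forall i, (0 < x ord0 i < 1)%R].

Definition C_space : set fn := [set u | {within cube, continuous u}].

Definition C_norm (u : fn) : \bar R := ereal_sup [set `|u x|%:E | x in cube].

Definition unit_dir (i : 'I_d) : pt := delta_mx ord0 i.

(* Iterated partial derivative; pderiv [:: i1; ...; ij] u is
   d_{i1} ( ... (d_{ij} u)). *)
Definition pderiv (l : seq 'I_d) (u : fn) : fn :=
  foldr (fun i v => (fun x => 'D_(unit_dir i) v x) : fn) u l.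

(* All iterated partial derivatives of order <= r exist in the open cube and
   extend continuously to the closed cube. *)
Definition Cr_space (r : nat) : set fn :=
  [set u | C_space u /\ forall l : seq 'I_d, (size l <= r)%N ->
    ((size l < r)%N -> forall i x, open_cube x ->
        derivable (pderiv l u) x (unit_dir i)) /\
    exists2 v, C_space v & {in open_cube, v =1 pderiv l u}].

(* Maximum over |alpha| <= r of the sup norm of D^alpha u; the supremum over
   the open cube is that of the continuous extension over the cube, and by
   symmetry of the derivatives sequences of directions stand for
   multi-indices. *)
Definition Cr_norm (r : nat) (u : fn) : \bar R :=
  ereal_sup [set e | exists l x,
    [/\ (size l <= r)%N, open_cube x & e = `|pderiv l u x|%:E]].

Definition test_function (psi : fn) : Prop :=
  (forall l : seq 'I_d, continuous (pderiv l psi) /\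
     forall x i, derivable (pderiv l psi) x (unit_dir i)) /\
  exists2 S : set pt, compact S /\ S `<=` open_cube &
    forall x, ~ S x -> psi x = 0%R.

(* Multi-indices all of whose entries are at most m. *)
Definition mindex (m : nat) := {ffun 'I_d -> 'I_m.+1}.

Definition morder m (a : mindex m) : nat := (\sum_i a i)%N.

Definition directions m (a : mindex m) : seq 'I_d :=
  flatten [seq nseq (a i) i | i <- enum 'I_d].

Definition is_weak_deriv m (a : mindex m) (u g : fn) : Prop :=
  L2 lebesgue open_cube g /\
  forall psi, test_function psi ->
    integral_over lebesgue open_cube (fun x => u x * pderiv (directions a) psi x)%R
    = ((-1) ^+ morder a *
       integral_over lebesgue open_cube (fun x => g x * psi x))%R.

(* A representative of the weak derivative, which is unique up to a null set. *)
Definition weak_deriv m (a : mindex m) (u : fn) : fn :=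
  xget (cst 0%R) [set g | is_weak_deriv a u g].

Definition slobodeckij (sigma : R) (g : fn) : \bar R :=
  \int[cara lebesgue]_(x in open_cube)
    \int[cara lebesgue]_(y in open_cube)
      ((g x - g y) ^+ 2 / enorm (x - y) `^ (d%:R + 2 * sigma))%:E.

(* Sobolev-Slobodeckij norm of real order s = m + sigma with m = floor s and
   0 <= sigma < 1. *)
Definition Hs_sqnorm (s : R) (u : fn) : \bar R :=
  let m := Num.truncn s in
  let sigma := (s - m%:R)%R in
  \sum_(a : mindex m | (morder a <= m)%N)
    \int[cara lebesgue]_(x in open_cube)
      ((weak_deriv a u x) ^+ 2)%:E
  + (if (0 < sigma)%R
     then \sum_(a : mindex m | morder a == m) slobodeckij sigma (weak_deriv a u)
     else 0).

Definition Hs_norm (s : R) (u : fn) : \bar R := poweR (Hs_sqnorm s u) 2^-1.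

Definition Hs_space (s : R) : set fn :=
  [set u | [/\ L2 lebesgue open_cube u,
    forall a : mindex (Num.truncn s), (morder a <= Num.truncn s)%N ->
      exists g, is_weak_deriv a u g
    & Hs_norm s u < +oo]].

End function_spaces.

Section functionals.
Context {R : realType} {d : nat}.
Local Notation fn := ('rV[R]_d -> R).

(* Functionals on C(V) and on C^r(V) share this carrier, so that restriction
   from C(V) to C^r(V) is silent and only the norm records the space acted on. *)
Definition functional := fn -> R.

Definition dual_C_norm (L : functional) : \bar R :=
  ereal_sup [set `|L u|%:E | u in [set u | C_space u /\ C_norm u <= 1]].

Definition dual_Cr_norm (r : nat) (L : functional) : \bar R :=
  ereal_sup [set `|L u|%:E | u in [set u | Cr_space r u /\ Cr_norm r u <= 1]].

Definition sub_pair (L L' : functional * functional) : functional * functional :=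
  (fun u => L.1 u - L'.1 u, fun u => L.2 u - L'.2 u)%R.

Definition dual_C_norm2 (L : functional * functional) : \bar R :=
  dual_C_norm L.1 + dual_C_norm L.2.

Definition dual_Cr_norm2 (r : nat) (L : functional * functional) : \bar R :=
  dual_Cr_norm r L.1 + dual_Cr_norm r L.2.

End functionals.

Arguments functional : clear implicits.

Section manifold_functions.
Context {R : realType} {d : nat}.
Local Notation pt := 'rV[R]_d.

(* First coordinate nonnegative; for k = 0 the one-point space. *)
Definition halfspace (k : nat) : set 'rV[R]_k :=
  [set y | forall i : 'I_k, i = 0%N :> nat -> (0 <= y ord0 i)%R].

Arguments halfspace k : clear implicits.

(* Manifolds possibly with boundary, embedded in R^d: every point of M has a
   relatively open neighbourhood homeomorphic to a relatively open subset of
   the half-space. *)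
Definition topological_manifold (k : nat) (M : set pt) : Prop :=
  forall x, M x -> exists (U : set pt) (W : set 'rV[R]_k)
      (g : pt -> 'rV[R]_k) (h : 'rV[R]_k -> pt),
    [/\ open U /\ U x, open W, g @` (M `&` U) = W `&` halfspace k,
        {in M `&` U, cancel g h} &
        {within M `&` U, continuous g} /\ {within W `&` halfspace k, continuous h}].

(* As above with bi-Lipschitz charts. *)
Definition lipschitz_manifold (k : nat) (M : set pt) : Prop :=
  forall x, M x -> exists (U : set pt) (W : set 'rV[R]_k)
      (g : pt -> 'rV[R]_k) (c : R),
    [/\ open U /\ U x, open W, g @` (M `&` U) = W `&` halfspace k, (0 < c)%R &
        forall y z, (M `&` U) y -> (M `&` U) z ->
          (c^-1 * enorm (y - z) <= enorm (g y - g z) <= c * enorm (y - z))%R].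

Definition manifold_union (k : nat) : set (set pt) :=
  [set M | exists (m : nat) (N : 'I_m.+1 -> set pt),
    [/\ M = \bigcup_i N i,
        forall i, [/\ N i `<=` cube, compact (N i), lipschitz_manifold k (N i)
                    & hausdorff k (N i) < +oo]
      & forall i j, i != j -> N i `&` N j = set0 \/
          exists2 k', (k' < k)%N & topological_manifold k' (N i `&` N j)]].

End manifold_functions.

(* Manifold functions (M, f_M), with f_M given by a representative of its class
   in L^2(M). Two representatives of the same class are at distance 0, so the
   distance below is a pseudometric and the metric space X_k is its Kolmogorov
   quotient; compactness of a set of classes is the same as compactness of the
   set of its representatives. *)
Record manifold_function (R : realType) (d k : nat) := ManifoldFunction {
  mf_set : set 'rV[R]_d ;
  mf_fun : 'rV[R]_d -> R ;
  mf_setP : manifold_union k mf_set ;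
  mf_funP : L2 (hausdorff k) mf_set mf_fun }.

HB.instance Definition _ (R : realType) d k := gen_eqMixin (manifold_function R d k).
HB.instance Definition _ (R : realType) d k := gen_choiceMixin (manifold_function R d k).

Section manifold_function_metric.
Context {R : realType} {d k : nat}.
Local Notation X := (manifold_function R d k).

Definition mf_embed (p : X) : functional R d * functional R d :=
  (fun u => integral_over (hausdorff k) (mf_set p) u,
   fun u => integral_over (hausdorff k) (mf_set p) (fun x => mf_fun p x * u x)%R).

Definition mf_dist (p q : X) : \bar R :=
  dual_C_norm2 (sub_pair (mf_embed p) (mf_embed q)).

Definition mf_ball (p : X) (e : R) : set X := [set q | mf_dist p q < e%:E].

Let unit_zero : ([set u : 'rV[R]_d -> R | C_space u /\ C_norm u <= 1]) (cst 0%R).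
Proof.
split; first by apply: continuous_subspaceT; exact: cst_continuous.
by apply: ge_ereal_sup => _ [x _ <-]; rewrite /= lee_fin normr0 ler01.
Qed.

Lemma dual_C_norm_ge0 (L : functional R d) : 0 <= dual_C_norm L.
Proof.
apply: (le_trans _ (ereal_sup_ubound _)); last by exists (cst 0%R).
by rewrite lee_fin.
Qed.

Lemma dual_C_norm_sym (L L' : functional R d) :
  dual_C_norm (fun u => L u - L' u)%R = dual_C_norm (fun u => L' u - L u)%R.
Proof.
by congr ereal_sup; apply: eq_imagel => u _; rewrite distrC.
Qed.

Lemma dual_C_norm_triangle (L L' L'' : functional R d) :
  dual_C_norm (fun u => L u - L'' u)%R <=
  dual_C_norm (fun u => L u - L' u)%R + dual_C_norm (fun u => L' u - L'' u)%R.
Proof.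
apply: ge_ereal_sup => _ [u u1 <-].
apply: (@le_trans _ _ (`|L u - L' u|%:E + `|L' u - L'' u|%:E)).
  by rewrite -EFinD lee_fin; exact: ler_distD.
by apply: leeD; apply: ereal_sup_ubound; exists u.
Qed.

Let mf_ball_center p (e : R) : (0 < e)%R -> mf_ball p e p.
Proof.
move=> e0; rewrite /mf_ball /= /mf_dist /dual_C_norm2/=.
suff L0 (L : functional R d) : dual_C_norm (fun u => L u - L u)%R = 0.
  by rewrite !L0 adde0 lte_fin.
apply/eqP; rewrite eq_le dual_C_norm_ge0 andbT.
by apply: ge_ereal_sup => _ [u _ <-]; rewrite subrr normr0.
Qed.

Let mf_ball_sym p q (e : R) : mf_ball p e q -> mf_ball q e p.
Proof.
rewrite /mf_ball /= /mf_dist /dual_C_norm2/=.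
by rewrite dual_C_norm_sym [X in _ + X < _]dual_C_norm_sym.
Qed.

Let mf_ball_triangle p q w (e1 e2 : R) :
  mf_ball p e1 q -> mf_ball q e2 w -> mf_ball p (e1 + e2) w.
Proof.
rewrite /mf_ball /= EFinD => pq qw.
have : mf_dist p q + mf_dist q w < e1%:E + e2%:E by exact: lteD.
apply: le_lt_trans; rewrite /mf_dist /dual_C_norm2/= addeACA.
by apply: leeD; exact: dual_C_norm_triangle.
Qed.

HB.instance Definition _ :=
  hasNbhs.Build X (fun p => nbhs_ (entourage_ mf_ball) p).

HB.instance Definition _ := @Nbhs_isPseudoMetric.Build R X
  (entourage_ mf_ball) erefl mf_ball mf_ball_center mf_ball_sym
  mf_ball_triangle erefl.

End manifold_function_metric.

Section projection.
Context {R : realType} {d N : nat}.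
Local Notation fn := ('rV[R]_d -> R).
Implicit Types (phi : 'I_N -> fn).

Definition lincomb phi (c : 'I_N -> R) : fn := fun x => (\sum_m c m * phi m x)%R.

Definition span phi : set fn := range (lincomb phi).

Definition lin_indep_on_cube phi : Prop :=
  forall c, {in cube, lincomb phi c =1 cst 0%R} -> forall m, c m = 0%R.

(* Pi^s: the minimizer of the H^s distance to the span. *)
Definition Hs_proj (s : R) phi (u : fn) : fn :=
  xget (cst 0%R) [set v | span phi v /\
    forall w, span phi w ->
      Hs_norm s (fun x => u x - v x)%R <= Hs_norm s (fun x => u x - w x)%R].

Definition is_dual_basis phi (e : 'I_N -> functional R d) : Prop :=
  (forall m a v w, span phi v -> span phi w ->
     e m (fun x => a * v x + w x)%R = (a * e m v + e m w)%R) /\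
  forall m j, e m (phi j) = (m == j)%:R.

Definition dual_basis phi : 'I_N -> functional R d :=
  xget (fun _ _ => 0%R) [set e | is_dual_basis phi e].

Definition estar (s : R) phi (m : 'I_N) : functional R d :=
  fun u => dual_basis phi m (Hs_proj s phi u).

Definition encoder phi (F : functional R d * functional R d) : 'rV[R]_(N + N) :=
  row_mx (\row_m F.1 (phi m)) (\row_m F.2 (phi m)).

(* A functional of (C^r)' is given by its values on C^r functions; the formula
   does not depend on r. *)
Definition decoder (s : R) phi (a : 'rV[R]_(N + N)) :
    functional R d * functional R d :=
  (fun u => \sum_m lsubmx a ord0 m * estar s phi m u,
   fun u => \sum_m rsubmx a ord0 m * estar s phi m u)%R.

Definition reconstruction (s : R) phi (F : functional R d * functional R d) :
    functional R d * functional R d :=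
  decoder s phi (encoder phi F).

End projection.

(* u n = O(1 / n^t) as n tends to infinity. *)
Definition bigO_rate (R : realType) (t : R) (u : nat -> \bar R) : Prop :=
  exists C : R, \forall n \near \oo, u n <= (C / n%:R `^ t)%:E.

(* Indices n range over the positive integers; values at n = 0 are unused. *)
Definition convergence_sequence (R : realType) (d r : nat) (s t : R)
    (kappa : nat -> nat) (phi : forall n, 'I_(kappa n) -> 'rV[R]_d -> R) : Prop :=
  [/\ forall n, (0 < n)%N -> (0 < kappa n)%N,
      forall n n', (0 < n)%N -> (n <= n')%N -> (kappa n <= kappa n')%N,
      forall n m, (0 < n)%N -> C_space (phi n m) /\ Hs_space s (phi n m),
      forall n, (0 < n)%N -> lin_indep_on_cube (phi n)
    & bigO_rate t (fun n =>
        ereal_sup [set C_norm (fun x => u x - Hs_proj s (phi n) u x)%R |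
          u in [set u | Cr_space r u /\ Cr_norm r u <= 1]])].

(* Norm of C(K, (C^r)' x (C^r)'). *)
Definition sup_norm_on (R : realType) (d k r : nat)
    (K : set (manifold_function R d k))
    (F : manifold_function R d k -> functional R d * functional R d) : \bar R :=
  ereal_sup [set dual_Cr_norm2 r (F p) | p in K].

(* Main.v *)
Require Import Defs.
From HB Require Import structures.
From mathcomp Require Import all_boot all_order all_algebra.
From mathcomp Require Import all_classical all_reals all_analysis.
From mathcomp Require Import measurable_realfun lra.
Import Order.TTheory GRing.Theory Num.Theory.
Import numFieldNormedType.Exports.
Local Open Scope classical_set_scope.
Local Open Scope ring_scope.

(** Since the dual basis recovers the coefficients of an element of the span,
    the reconstruction of a pair [F] of linear functionals is
    [u |-> F (Pi u)] with [Pi] the projection ([reconstructionE]). The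
    reconstruction error therefore sends [u] to [F (Pi u - u)], which is at most
    the norm of [F] on continuous functions times the sup norm of [u - Pi u].
    The second factor is [O(1 / n^t)] uniformly in the unit ball of [C^r] by
    hypothesis, and the first one is bounded over [K]
    ([compact_dual_C_norm2_bounded]): the norm is 1-Lipschitz and finite for
    each manifold function, so it is locally bounded, hence bounded on a
    compact set.

    Pulling the finite sum over the basis through [F], and rewriting the error
    as [F (Pi u - u)], needs the integral functionals of a manifold function to
    be linear on continuous functions. Integrals are taken with respect to the
    Caratheodory sigma-algebra of the Hausdorff outer measure, so linearity
    rests on the measurability of continuous functions for that sigma-algebra.
    This is Caratheodory's criterion: an outer measure that is additive on sets
    at positive distance makes closed sets measurable
    ([closed_caratheodory]), and the Hausdorff outer measure is of that kind
    because coverings by sets of small diameter separate such sets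
    ([hausdorff_metric_additive]). *)

(** * Metric outer measures and Caratheodory's criterion *)

Section metric_outer_measure.
Set Implicit Arguments.
Unset Strict Implicit.
Unset Printing Implicit Defensive.
Context {R : realType}.
Local Open Scope ereal_scope.

(** A covering of the union splits into the members that meet [A] and those
    that meet [B]; no member of a covering of finite weight does both. *)
Lemma cover_outer_superadditive (T : Type) (g : set T -> \bar R) (A B : set T) :
  g set0 = 0 -> (forall F, 0 <= g F) ->
  (forall F, F `&` A !=set0 -> F `&` B !=set0 -> g F = +oo) ->
  cover_outer g A + cover_outer g B <= cover_outer g (A `|` B).
Proof.
move=> g0 g_ge0 gAB.
apply: le_ereal_inf_tmp => _ [F /= ABF <-].
pose FA n := if `[< F n `&` A !=set0 >] then F n else set0.
pose FB n := if `[< F n `&` B !=set0 >] then F n else set0.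
have FA_cover : cover_outer g A <= \sum_(n <oo) g (FA n).
  apply: ereal_inf_lbound; exists FA => //= x Ax.
  have [n _ Fnx] := ABF x (or_introl Ax).
  by exists n => //; rewrite /FA asboolT//; exists x.
have FB_cover : cover_outer g B <= \sum_(n <oo) g (FB n).
  apply: ereal_inf_lbound; exists FB => //= x Bx.
  have [n _ Fnx] := ABF x (or_intror Bx).
  by exists n => //; rewrite /FB asboolT//; exists x.
apply: (le_trans (leeD FA_cover FB_cover)).
rewrite -nneseriesD//.
apply: lee_nneseries => [i _ _|i _]; first by rewrite adde_ge0.
rewrite /FA /FB; case: asboolP => [FiA|_]; case: asboolP => [FiB|_].
- by rewrite (gAB _ FiA FiB) leey.
- by rewrite g0 adde0.
- by rewrite g0 add0e.
- by rewrite g0 adde0.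
Qed.

(** Only superadditivity is asked for: the other inequality holds for every
    outer measure. *)
Definition metric_additive (V : normedModType R) (mu : set V -> \bar R) :=
  forall (e : R) (A B : set V), (0 < e)%R ->
    (forall x y, A x -> B y -> (e <= `|x - y|)%R) ->
    mu A + mu B <= mu (A `|` B).

(** Caratheodory's criterion. Exhaust [X `\` A] by the sets [E n] of points at
    distance at least [1/(n+1)] from [A]. Each [E n] is at positive distance
    from [A], so that [mu (X `&` A) + mu (E n) <= mu X], and it remains to see
    that [mu (X `\` A)] is at most the supremum of the numbers [mu (E n)]. The
    layer [r n = E n.+1 `\` E n] is at positive distance from [E n.-1], hence
    [mu (E n) + mu (r n.+1) <= mu (E n.+2)]. These inequalities telescope to a
    bound on the total measure of the layers beyond a given one. *)
Lemma closed_caratheodory (V : normedModType R)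
    (mu : {outer_measure set V -> \bar R}) (A : set V) :
  metric_additive mu -> closed A -> mu.-caratheodory A.
Proof.
move=> mu_add clA; apply: le_caratheodory_measurable => X.
have [->|/eqP muXoo] := eqVneq (mu X) +oo; first by rewrite leey.
have fin_sub Y : Y `<=` X -> mu Y \is a fin_num.
  move=> YX; rewrite ge0_fin_numE ?outer_measure_ge0//.
  by rewrite (le_lt_trans (le_outer_measure mu _ _ YX))// ltey; apply/eqP.
have inv_gt0 n : (0 < n.+1%:R^-1 :> R)%R by rewrite invr_gt0.
pose E n := [set x | X x /\ forall a, A a -> (n.+1%:R^-1 <= `|x - a|)%R].
have E_X n : E n `<=` X by move=> x [].
pose r n := E n.+1 `\` E n.
have r_X n : r n `<=` X by move=> x [/E_X].
pose a n := fine (mu (E n)).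
have aE n : mu (E n) = (a n)%:E by rewrite fineK// fin_sub.
pose b n := fine (mu (r n)).
have bE n : mu (r n) = (b n)%:E by rewrite fineK// fin_sub.
have E_incr n : E n `<=` E n.+1.
  move=> x [Xx Ex]; split => // y Ay; apply: le_trans (Ex y Ay).
  by rewrite lef_pV2 ?posrE// ler_nat.
have a_incr n : (a n <= a n.+1)%R.
  by rewrite -lee_fin -!aE; exact: le_outer_measure.
pose c := (fine (mu X) - fine (mu (X `&` A)))%R.
have XAfin : mu (X `&` A) \is a fin_num by apply: fin_sub => x [].
have a_le_c n : (a n <= c)%R.
  rewrite /c lerBrDl -lee_fin EFinD -aE !fineK//; last by exact: fin_sub.
  apply: (@le_trans _ _ (mu ((X `&` A) `|` E n))).
    apply: (mu_add _ _ _ (inv_gt0 n)) => x y [Xx Ax] [Xy Ey].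
    by rewrite distrC; exact: Ey.
  by apply: le_outer_measure => x [[]|/E_X].
have ab n : (a n + b n.+1 <= a n.+2)%R.
  rewrite -lee_fin EFinD -aE -bE -aE.
  apply: (@le_trans _ _ (mu (E n `|` r n.+1))).
    have ltn : (0 < n.+1%:R^-1 - n.+2%:R^-1 :> R)%R.
      by rewrite subr_gt0 ltf_pV2 ?posrE// ltr_nat.
    apply: (mu_add _ _ _ ltn) => x y [Xx Ex] [[Xy Ey] nEy].
    have [z Az yz] : exists2 z, A z & (`|y - z| < n.+2%:R^-1)%R.
      apply: contrapT => nz; apply: nEy; split=> // z Az.
      by rewrite leNgt; apply/negP => yz; apply: nz; exists z.
    rewrite lerBlDr; apply: (le_trans (Ex z Az)).
    by apply: (le_trans (ler_distD y _ _)); rewrite lerD2l ltW.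
  apply: le_outer_measure => x [Ex|[]//].
  by apply/E_incr/E_incr.
(* Two boundary terms survive at each end, as consecutive indices are linked in
   steps of two. *)
have b_sum N m :
    (\sum_(N <= i < (N + m)%N) b i.+1 <= a (N + m)%N + a (N + m).+1%N - a N - a N.+1)%R.
  elim: m => [|m IH]; first by rewrite addn0 big_geq//; lra.
  rewrite addnS big_nat_recr/= ?leq_addr//.
  by have := ab (N + m)%N; move: IH; lra.
(* [X `\` A] is covered by [E N.+1] and the layers [r i.+1] with [N <= i];
   bounding the layers by [b_sum], the contribution of [a N.+1] cancels. *)
have tail N : mu (X `&` ~` A) <= (2 * sup (range a) - a N)%:E.
  have bsup i : (a i <= sup (range a))%R.
    apply: ub_le_sup; last by exists i.
    by exists c => _ [n _ <-].
  pose F n := if n is m.+1 then r (N + m).+1%N else E N.+1.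
  have XA_F : X `&` ~` A `<=` \bigcup_n F n.
    move=> x [Xx nAx].
    have [n Enx] : exists n, E n x.
      have : nbhs x (~` A) by apply: open_nbhs_nbhs; split => //; exact: closed_openC.
      move=> /nbhs_ballP[e /= e0 xeA].
      have [n ne] : exists n, (n.+1%:R^-1 < e)%R.
        exists (Num.truncn e^-1); rewrite invf_plt ?posrE//.
        exact: truncnS_gt.
      exists n; split=> // z Az; rewrite leNgt; apply/negP => xz.
      by apply: (xeA z) => //; rewrite -ball_normE/=; exact: lt_trans ne.
    have [ENx|nENx] := pselect (E N.+1 x); first by exists 0%N.
    (* Otherwise the first set [E m] containing [x] has [N.+1 < m]. *)
    have E_mono i j : (i <= j)%N -> E i `<=` E j.
      move=> /subnKC <-; elim: (j - i)%N => [|m IH]; first by rewrite addn0.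
      by rewrite addnS => y /IH/E_incr.
    have exE : exists n, `[< E n x >] by exists n; exact/asboolP.
    case: (ex_minnP exE) => m /asboolP Emx m_min.
    have Nm : (N.+1 < m)%N by rewrite ltnNge; apply/negP => /E_mono/(_ _ Emx).
    exists (m - N.+2).+1 => //=; rewrite /r.
    have -> : (N + (m - N.+2)).+2%N = m by rewrite -!addSn subnKC.
    have -> : (N + (m - N.+2)).+1%N = m.-1 by rewrite -[in RHS](subnKC Nm).
    split=> // Em1x; have := m_min _ (introT (asboolP _) Em1x).
    by rewrite leqNgt ltn_predL (leq_trans _ Nm).
  apply: (le_trans (le_outer_measure mu _ _ XA_F)).
  apply: (le_trans (outer_measure_sigma_subadditive mu F)).
  rewrite nneseries_recl ?outer_measure_ge0//.
  apply: (@le_trans _ _ ((a N.+1)%:E + (2 * sup (range a) - a N - a N.+1)%:E)); last first.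
    by rewrite -EFinD lee_fin addrCA subrr addr0.
  rewrite aE leeD2l//.
  apply: lime_le; first by apply: is_cvg_nneseries => *; exact: outer_measure_ge0.
  apply: nearW => -[|m].
    rewrite big_geq// lee_fin; have := bsup N; have := bsup N.+1.
    by move=> h1 h2; rewrite -addrA -opprD subr_ge0 mulr_natl mulr2n lerD.
  rewrite big_add1/= (eq_bigr (fun i => (b (N + i).+1%N)%:E)); last first.
    by move=> i _; rewrite bE.
  rewrite sumEFin lee_fin.
  have -> : (\sum_(0 <= i < m) b (N + i).+1%N = \sum_(N <= i < (N + m)%N) b i.+1)%R.
    rewrite -{2}[N]add0n [in RHS]big_addn addKn.
    by apply: eq_bigr => i _; rewrite addnC.
  apply: (le_trans (b_sum N m)); rewrite !lerD2r mulr_natl mulr2n.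
  exact: lerD.
have XAc : mu (X `&` ~` A) <= c%:E.
  apply/lee_addgt0Pr => e e0.
  have ha : has_sup (range a).
    by split; [exists (a 0%N), 0%N|exists c => _ [n _ <-]].
  have [_ [N _ <-] aN] := sup_adherent e0 ha.
  apply: (le_trans (tail N)); rewrite -EFinD lee_fin.
  have supc : (sup (range a) <= c)%R.
    by apply: ge_sup => [|_ [n _ <-]//]; exists (a 0%N), 0%N.
  rewrite lerBlDr mulr_natl mulr2n -addrA lerD//.
  by rewrite addrC -lerBlDr ltW.
apply: (le_trans (leeD2l _ XAc)).
rewrite /c EFinB !fineK//; last exact: fin_sub.
by rewrite addeCA subee ?adde0.
Qed.

(** The norm of ['rV[R]_n] is the max norm, whereas diameters are Euclidean;
    this comparison passes from separation in the former to a lower bound on the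
    latter. *)
Lemma enorm_ge_normr n (x : 'rV[R]_n) : (`|x|%R <= enorm x)%R.
Proof.
rewrite [`|x|%R]/Num.norm/= mx_normrE; apply: bigmax_le; first exact: sqrtr_ge0.
move=> [i j] _ /=; rewrite (ord1 i) -sqrtr_sqr ler_wsqrtr//.
by rewrite (bigD1 j)//= lerDl sumr_ge0// => l _; exact: sqr_ge0.
Qed.

Lemma le_cover_outer_gauge (T : Type) (g1 g2 : set T -> \bar R) (A : set T) :
  (forall F, 0 <= g1 F) -> (forall F, g1 F <= g2 F) ->
  cover_outer g1 A <= cover_outer g2 A.
Proof.
move=> g1_ge0 g12; apply: le_ereal_inf_tmp => _ [F AF <-].
apply: (@le_trans _ _ (\sum_(n <oo) g1 (F n))).
  by apply: ereal_inf_lbound; exists F.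
by apply: lee_nneseries.
Qed.

Lemma le_hausdorff_gauge n k (d1 d2 : R) (F : set 'rV[R]_n) : (d1 <= d2)%R ->
  hausdorff_gauge k d2 F <= hausdorff_gauge k d1 F.
Proof.
move=> d12; rewrite /hausdorff_gauge; case: ifP => // _.
case: ifPn => [_|n2]; case: ifPn => [d1F|_]; rewrite ?leey//.
by move: n2; rewrite (le_trans d1F)// lee_fin.
Qed.

(** A set of diameter less than the distance [e] between [A] and [B] cannot
    meet both. The two suprema over the scale are treated independently: each
    pair of scales is refined by a common one smaller than [e]. *)
Lemma hausdorff_metric_additive n k : metric_additive (@hausdorff R n k).
Proof.
move=> e A B e0 eAB.
have [->|/eqP ABoo] := eqVneq (hausdorff k (A `|` B)) +oo; first by rewrite leey.
have fin_sub Y : Y `<=` A `|` B -> hausdorff k Y \is a fin_num.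
  move=> YX; rewrite ge0_fin_numE ?hausdorff_ge0//.
  by rewrite (le_lt_trans (@le_hausdorff _ _ _ _ _ YX))// ltey; apply/eqP.
have key (d1 d2 : R) : (0 < d1)%R -> (0 < d2)%R ->
    cover_outer (hausdorff_gauge k d1) A + cover_outer (hausdorff_gauge k d2) B <=
    hausdorff k (A `|` B).
  move=> d10 d20; pose dl := (Num.min (Num.min d1 d2) (e / 2))%R.
  have dl0 : (0 < dl)%R by rewrite !lt_min d10 d20 divr_gt0.
  have dle : (dl < e)%R.
    by rewrite gt_min orbC ltr_pdivrMr// mulr_natr mulr2n ltrDl e0.
  apply: (@le_trans _ _ (cover_outer (hausdorff_gauge k dl) (A `|` B))); last first.
    by apply: ereal_sup_ubound; exists dl.
  apply: (@le_trans _ _ (cover_outer (hausdorff_gauge k dl) A +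
                         cover_outer (hausdorff_gauge k dl) B)).
    apply: leeD; apply: le_cover_outer_gauge => F;
      rewrite ?hausdorff_gauge_ge0//; apply: le_hausdorff_gauge.
      by rewrite !ge_min lexx.
    by rewrite !ge_min lexx orbT.
  apply: cover_outer_superadditive => [|F|F [x [Fx Ax]] [y [Fy By]]].
  - exact: hausdorff_gauge0.
  - exact: hausdorff_gauge_ge0.
  rewrite /hausdorff_gauge ifF; last by apply/negP => /eqP F0; rewrite F0 in Fx.
  rewrite ifF//; apply/negbTE; rewrite -ltNge.
  apply: (@lt_le_trans _ _ e%:E); first by rewrite lte_fin.
  apply: (@le_trans _ _ (enorm (x - y))%:E).
    by rewrite lee_fin (le_trans (eAB _ _ Ax By))// enorm_ge_normr.
  by apply: ereal_sup_ubound; exists x, y.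
have Bfin : hausdorff k B \is a fin_num by apply: fin_sub => x; right.
have Afin (d1 : R) : (0 < d1)%R -> cover_outer (hausdorff_gauge k d1) A \is a fin_num.
  move=> d10; rewrite ge0_fin_numE; last first.
    by apply: cover_outer_ge0 => F; exact: hausdorff_gauge_ge0.
  have : hausdorff k A < +oo by rewrite ltey_eq fin_sub// => x; left.
  by apply: le_lt_trans; apply: ereal_sup_ubound; exists d1.
rewrite -leeBrDr//; apply: ge_ereal_sup => _ [d1 /= d10 <-].
rewrite leeBrDr// -leeBrDl ?Afin//; apply: ge_ereal_sup => _ [d2 /= d20 <-].
by rewrite leeBrDl ?Afin//; exact: key.
Qed.

End metric_outer_measure.

Section reconstruction_error.
Set Implicit Arguments.
Unset Strict Implicit.
Unset Printing Implicit Defensive.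
Context {R : realType} {d : nat}.
Local Notation pt := 'rV[R]_d.
Local Notation fn := (pt -> R).

(** * Linear functionals on spaces of functions *)

Definition lin_closed (S : set fn) : Prop :=
  S (cst 0) /\ forall (a : R) (u v : fn), S u -> S v -> S (fun x => a * u x + v x).

Definition linear_on (S : set fn) (L : functional R d) : Prop :=
  forall (a : R) (u v : fn), S u -> S v ->
    L (fun x => a * u x + v x) = a * L u + L v.

Section linear_on.
Variables (S : set fn) (L : functional R d).
Hypotheses (S_lin : lin_closed S) (L_lin : linear_on S L).

Lemma linear_on0 : L (cst 0) = 0.
Proof.
have := L_lin 1 S_lin.1 S_lin.1.
have -> : (fun x : pt => 1 * cst 0 x + cst 0 x : R) = cst 0.
  by apply/funext => x /=; rewrite mulr0 addr0.
by rewrite mul1r -[LHS]addr0 => /addrI.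
Qed.

Lemma linear_onZ (a : R) (u : fn) : S u -> L (fun x => a * u x) = a * L u.
Proof.
move=> Su; rewrite -[RHS]addr0 -linear_on0 -L_lin//; last exact: S_lin.1.
by congr L; apply/funext => x /=; rewrite addr0.
Qed.

Lemma linear_onB (u v : fn) : S u -> S v -> L (fun x => u x - v x) = L u - L v.
Proof.
move=> Su Sv.
have -> : (fun x => u x - v x) = (fun x => -1 * v x + u x).
  by apply/funext => x; rewrite mulN1r addrC.
by rewrite L_lin// mulN1r addrC.
Qed.

Lemma linear_on_lincomb N (phi : 'I_N -> fn) (c : 'I_N -> R) :
  (forall m, S (phi m)) ->
  S (lincomb phi c) /\ L (lincomb phi c) = \sum_m c m * L (phi m).
Proof.
elim: N phi c => [|N IH] phi c Sphi.
  rewrite big_ord0 (_ : lincomb phi c = cst 0); last first.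
    by apply/funext => x; rewrite /lincomb big_ord0.
  by rewrite linear_on0; split=> //; exact: S_lin.1.
have [Sl Ll] := IH _ (fun m => c (lift ord0 m)) (fun m => Sphi (lift ord0 m)).
rewrite big_ord_recl -Ll -L_lin//.
rewrite (_ : lincomb phi c = fun x => c ord0 * phi ord0 x +
    lincomb (fun m => phi (lift ord0 m)) (fun m => c (lift ord0 m)) x); last first.
  by apply/funext => x; rewrite /lincomb big_ord_recl.
by split=> //; exact: S_lin.2.
Qed.

End linear_on.

Lemma C_space_lin_closed : lin_closed C_space.
Proof.
split; first by apply: continuous_subspaceT; exact: cst_continuous.
move=> a u v cu cv x; apply: cvgD; last exact: cv.
by apply: cvgMr; exact: cu.
Qed.

(** The unit ball only tests functions of norm at most 1, so [g] has to be
    rescaled; a bound [e > 0] is used in place of the norm of [g], which may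
    vanish. *)
Lemma le_dual_C_norm (L : functional R d) (g : fn) (e : R) :
  linear_on C_space L -> C_space g -> 0 < e -> (C_norm g <= e%:E)%E ->
  (`|L g|%:E <= e%:E * dual_C_norm L)%E.
Proof.
move=> linL cg e0 ge.
have cg' : C_space (fun x => e^-1 * g x).
  have := C_space_lin_closed.2 e^-1 _ _ cg C_space_lin_closed.1; congr C_space.
  by apply/funext => x /=; rewrite addr0.
have -> : L g = e * L (fun x => e^-1 * g x).
  by rewrite (linear_onZ C_space_lin_closed)// mulrA divff ?gt_eqF// mul1r.
rewrite normrM (gtr0_norm e0) EFinM lee_pmul2l ?lte_fin//.
apply: ereal_sup_ubound; exists (fun x => e^-1 * g x) => //; split=> //.
apply: ge_ereal_sup => _ [x xcube <-].
rewrite lee_fin normrM gtr0_norm ?invr_gt0// ler_pdivrMl// mulr1 -lee_fin.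
by apply: le_trans ge; apply: ereal_sup_ubound; exists x.
Qed.

(** * Integral functionals of manifold functions *)

Lemma within_continuous_measurable (mu : {outer_measure set pt -> \bar R})
    (M : set pt) (u : fn) :
  metric_additive mu -> compact M -> {within M, continuous u} ->
  measurable_fun (M : set (caratheodory_type mu)) (u : caratheodory_type mu -> R).
Proof.
move=> mu_add cM cu.
have clM : closed M by apply: compact_closed => //; exact: norm_hausdorff.
apply: (measurability (@RGenCInfty.G R)) => [|/= _ [_] [r] -> <-].
  exact: RGenCInfty.measurableE.
apply: closed_caratheodory => //.
have /continuous_closedP/(_ `[r, +oo[%classic) := cu.
have cl_ray : closed `[r, +oo[%classic by rewrite set_itvcy; exact: closed_ge.
move=> /(_ cl_ray)/closed_subspaceP[V clV VM].
by rewrite setIC -VM; exact: closedI.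
Qed.

Lemma C_space_bounded_on (M : set pt) (u : fn) :
  compact M -> M `<=` cube -> C_space u -> [bounded u x | x in M].
Proof.
move=> cM Mcube /(continuous_subspaceW Mcube) cu.
have /compact_bounded[b [b_real hb]] := continuous_compact cu cM.
by exists b; split => // x bx y My; apply: (hb x bx); exists y.
Qed.

Lemma manifold_union_compact k (M : set pt) : manifold_union k M ->
  [/\ compact M, M `<=` cube & (hausdorff k M < +oo)%E].
Proof.
move=> [m [N [MN NP _]]].
have -> : M = \big[setU/set0]_(i < m.+1) N (inord i).
  rewrite -(bigcup_mkord m.+1 (fun i => N (inord i))) MN.
  apply/seteqP; split=> x [i _ Nx]; last by exists (inord i).
  by exists (i : nat) => //=; rewrite inord_val.
split.
- by apply: bigsetU_compact => i _; have [] := NP (inord i).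
- rewrite -(bigcup_mkord m.+1 (fun i => N (inord i))) => x [i _].
  by have [+ _ _ _] := NP (inord i); exact.
apply: (le_lt_trans (outer_measure_subadditive (hausdorff k) (fun i => N (inord i)) _)).
by apply: lte_sum_pinfty => i _; have [] := NP (inord i).
Qed.

Section weighted_integral.
(* Both components of a manifold function are instances: the weight is 1 for the
   manifold itself and [f_M] for the function. *)
Variables (mu : {outer_measure set pt -> \bar R}) (M : set pt) (f : fn).
Hypotheses (mu_add : metric_additive mu) (cM : compact M) (Mcube : M `<=` cube).
Hypothesis intf : (cara mu).-integrable (M : set (caratheodory_type mu)) (EFin \o f).

Let L : functional R d := fun u => integral_over mu M (fun x => f x * u x).

Let mM : measurable (M : set (caratheodory_type mu)).
Proof.
apply: closed_caratheodory => //.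
by apply: compact_closed => //; exact: norm_hausdorff.
Qed.

Let integrable_weighted (u : fn) : C_space u ->
  (cara mu).-integrable (M : set (caratheodory_type mu))
    (EFin \o (fun x => f x * u x)).
Proof.
move=> cu; have mu_u : measurable_fun (M : set (caratheodory_type mu))
    (u : caratheodory_type mu -> R).
  by apply: within_continuous_measurable => //; exact: continuous_subspaceW cu.
exact: (integrableMl mM intf mu_u (C_space_bounded_on cM Mcube cu)).
Qed.

Lemma weighted_integral_linear : linear_on C_space L.
Proof.
move=> a u v cu cv; rewrite /L /integral_over.
rewrite -RintegralZl//; last exact: integrable_weighted.
rewrite -RintegralD//; first last.
- exact: integrable_weighted.
- apply: (integrableZl mM a (integrable_weighted cu)).
by apply: eq_Rintegral => x _; rewrite mulrDr mulrCA.
Qed.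

Lemma weighted_integral_bounded : (dual_C_norm L < +oo)%E.
Proof.
apply: (@le_lt_trans _ _ (integral_over mu M (fun x => `|f x|))%:E); last exact: ltry.
apply: ge_ereal_sup => _ [u [cu u1] <-]; rewrite lee_fin.
have intfu := integrable_weighted cu.
apply: (le_trans (le_normr_Rintegral mM intfu)).
apply: le_Rintegral => //; [exact: integrable_norm|exact: integrable_norm|].
move=> x Mx /=; rewrite normrM ler_piMr// -lee_fin.
by apply: le_trans u1; apply: ereal_sup_ubound; exists x => //; exact: Mcube.
Qed.

End weighted_integral.

(** [|f| <= 1 + f^2], and constants are integrable on a set of finite measure. *)
Lemma L2_integrable (mu : {outer_measure set pt -> \bar R}) (M : set pt) (f : fn) :
  measurable (M : set (caratheodory_type mu)) -> (mu M < +oo)%E -> L2 mu M f ->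
  (cara mu).-integrable (M : set (caratheodory_type mu)) (EFin \o f).
Proof.
move=> mM Mfin [mf f2].
have int1 : (cara mu).-integrable (M : set (caratheodory_type mu)) (EFin \o cst 1).
  apply: measurable_bounded_integrable => //.
  by exists 1; split => // x x1 y _; rewrite /= normr1 ltW.
have mf2 : measurable_fun (M : set (caratheodory_type mu))
    (fun x : caratheodory_type mu => f x ^+ 2).
  exact: measurable_funX.
have int2 : (cara mu).-integrable (M : set (caratheodory_type mu))
    (EFin \o (fun x => f x ^+ 2)).
  apply/integrableP; split; first exact/measurable_EFinP.
  by under eq_integral do rewrite /= ger0_norm ?sqr_ge0//.
have mEf : measurable_fun (M : set (caratheodory_type mu))
    (EFin \o f : caratheodory_type mu -> \bar R) by exact/measurable_EFinP.
have int12 := integrableD mM int1 int2.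
refine (le_integrable mM mEf _ int12) => x _.
rewrite /= lee_fin [leRHS]ger0_norm ?addr_ge0 ?sqr_ge0//.
rewrite -(real_normK (num_real (f x))); have := normr_ge0 (f x).
move: `|f x| => y y0; nra.
Qed.

Section embedding.
Variable k : nat.
Implicit Type p : manifold_function R d k.

Lemma mf_embedE p :
  (mf_embed p).1 = (fun u => integral_over (hausdorff k) (mf_set p) (fun x => cst 1 x * u x)).
Proof.
apply/funext => u; rewrite /mf_embed/=; congr integral_over.
by apply/funext => x; rewrite mul1r.
Qed.

Lemma mf_embed_integrable p :
  (cara (hausdorff k)).-integrable
    (mf_set p : set (caratheodory_type (hausdorff k))) (EFin \o cst 1) /\
  (cara (hausdorff k)).-integrable
    (mf_set p : set (caratheodory_type (hausdorff k))) (EFin \o mf_fun p).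
Proof.
have [cM Mcube Mfin] := manifold_union_compact (mf_setP p).
have mM : measurable (mf_set p : set (caratheodory_type (hausdorff k))).
  apply: closed_caratheodory; first exact: hausdorff_metric_additive.
  by apply: compact_closed => //; exact: norm_hausdorff.
split; last exact: (L2_integrable mM Mfin (mf_funP p)).
apply: measurable_bounded_integrable => //.
by exists 1; split => // x x1 y _; rewrite /= normr1 ltW.
Qed.

Lemma mf_embed_linear p : linear_on C_space (mf_embed p).1 /\ linear_on C_space (mf_embed p).2.
Proof.
have [cM Mcube _] := manifold_union_compact (mf_setP p).
have [int1 intf] := mf_embed_integrable p.
split; [rewrite mf_embedE|];
  apply: weighted_integral_linear => //; exact: hausdorff_metric_additive.
Qed.

Lemma mf_embed_bounded p : (dual_C_norm2 (mf_embed p) < +oo)%E.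
Proof.
have [cM Mcube _] := manifold_union_compact (mf_setP p).
have [int1 intf] := mf_embed_integrable p.
rewrite /dual_C_norm2 lte_add_pinfty//; [rewrite mf_embedE|];
  apply: weighted_integral_bounded => //; exact: hausdorff_metric_additive.
Qed.

Lemma dual_C_norm2_le_dist p q :
  (dual_C_norm2 (mf_embed q) <= dual_C_norm2 (mf_embed p) + mf_dist p q)%E.
Proof.
have sub0 (L : functional R d) : dual_C_norm (fun u => L u - cst 0 u) = dual_C_norm L.
  by congr dual_C_norm; apply/funext => u; rewrite subr0.
have tri (L L' : functional R d) :
    (dual_C_norm L' <= dual_C_norm L + dual_C_norm (fun u => L u - L' u)%R)%E.
  have := dual_C_norm_triangle L' L (cst 0).
  by rewrite !sub0 addeC dual_C_norm_sym.
rewrite /mf_dist /dual_C_norm2/= addeACA.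
by apply: leeD; exact: tri.
Qed.

(** By [dual_C_norm2_le_dist], the norm at [p] plus 1 bounds the norm on the unit
    ball around [p]; compactness, as a near-covering property, turns these local
    bounds into a global one. *)
Lemma compact_dual_C_norm2_bounded (K : set (manifold_function R d k)) :
  compact K -> exists B : R, 0 < B /\
    forall p, K p -> (dual_C_norm2 (mf_embed p) <= B%:E)%E.
Proof.
move=> /compact_near_coveringP cK.
have : \forall B \near +oo, K `<=` (fun p => dual_C_norm2 (mf_embed p) <= B%:E)%E.
  apply: (cK R +oo (fun B p => dual_C_norm2 (mf_embed p) <= B%:E)%E) => p Kp.
  have pfin : dual_C_norm2 (mf_embed p) \is a fin_num.
    by rewrite ge0_fin_numE ?mf_embed_bounded// adde_ge0 ?dual_C_norm_ge0.
  exists (ball p 1, [set B | fine (dual_C_norm2 (mf_embed p)) + 1 <= B]).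
    split; first exact: nbhsx_ballx.
    by apply: nbhs_pinfty_ge; exact: num_real.
  move=> [q B] /= [pq pB]; apply: (le_trans (dual_C_norm2_le_dist p q)).
  apply: (@le_trans _ _ ((fine (dual_C_norm2 (mf_embed p)))%:E + 1%:E)%E).
    by rewrite fineK// leeD2l// ltW.
  by rewrite -EFinD lee_fin.
move=> KB; near (pinfty_nbhs R) => B.
exists B; split; first by near: B; exact: nbhs_pinfty_gt.
by near: B.
Unshelve. all: by end_near. Qed.

End embedding.

(** * Dual basis and reconstruction *)

Section dual_basis_theory.
Variables (N : nat) (phi : 'I_N -> fn).
Hypothesis phi_indep : lin_indep_on_cube phi.

Lemma lincomb_inj : injective (lincomb phi).
Proof.
move=> c c' cc'; apply/funext => m; apply/eqP; rewrite -subr_eq0; apply/eqP.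
apply: (@phi_indep (fun m => c m - c' m)) => x _; rewrite /lincomb/=.
under eq_bigr do rewrite mulrBl.
by rewrite sumrB -/(lincomb phi c x) -/(lincomb phi c' x) cc' subrr.
Qed.

Lemma lincomb_lin (a : R) (c c' : 'I_N -> R) :
  (fun x => a * lincomb phi c x + lincomb phi c' x) =
  lincomb phi (fun m => a * c m + c' m).
Proof.
apply/funext => x; rewrite /lincomb mulr_sumr -big_split/=.
by apply: eq_bigr => i _; rewrite mulrDl mulrA.
Qed.

Lemma span_lin_closed : lin_closed (Defs.span phi).
Proof.
split.
  by exists (fun=> 0) => //; apply/funext => x; rewrite /lincomb big1// => i _; rewrite mul0r.
move=> a _ _ [c _ <-] [c' _ <-]; exists (fun m => a * c m + c' m) => //.
by rewrite lincomb_lin.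
Qed.

Lemma delta_lincomb j : phi j = lincomb phi (fun i => (i == j)%:R).
Proof.
apply/funext => x; rewrite /lincomb (bigD1 j)//= eqxx mul1r big1 ?addr0//.
by move=> i /negbTE ->; rewrite mul0r.
Qed.

(** By injectivity of [lincomb phi], the coordinates of an element of the span
    are well defined, and they form a dual basis. *)
Lemma dual_basisP : is_dual_basis phi (dual_basis phi).
Proof.
suff [e he] : exists e, is_dual_basis phi e by exact: (xgetI _ he).
pose coef v := xget (fun=> 0) [set c | lincomb phi c = v].
have coefE c : coef (lincomb phi c) = c.
  by rewrite /coef; case: xgetP => [c' _ /lincomb_inj//|/(_ c)]; case.
exists (fun m v => coef v m); split; last first.
  by move=> m j; rewrite {1}delta_lincomb coefE.
by move=> m a _ _ [c _ <-] [c' _ <-]; rewrite lincomb_lin !coefE.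
Qed.

Lemma dual_basis_lincomb (c : 'I_N -> R) m : dual_basis phi m (lincomb phi c) = c m.
Proof.
have [e_lin e_delta] := dual_basisP.
have [_ ->] := linear_on_lincomb span_lin_closed (e_lin m) c
  (fun j => ex_intro2 _ _ _ I (esym (delta_lincomb j))).
rewrite (bigD1 m)//= e_delta eqxx mulr1 big1 ?addr0// => j jm.
by rewrite e_delta eq_sym (negbTE jm) mulr0.
Qed.

(** A minimizer lies in the span by definition, and the value 0 that replaces a
    missing minimizer lies there too. *)
Lemma Hs_proj_span (s : R) (u : fn) : Defs.span phi (Hs_proj s phi u).
Proof.
by rewrite /Hs_proj; case: xgetP => [v _ []//|_]; exact: span_lin_closed.1.
Qed.

(** Writing [Pi u] in the basis, the coefficients are the values of the dual
    basis, and linearity of [F] reassembles [F (Pi u)]. *)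
Lemma reconstructionE (s : R) (F : functional R d * functional R d) :
  (forall m, C_space (phi m)) -> linear_on C_space F.1 -> linear_on C_space F.2 ->
  reconstruction s phi F =
  (fun u => F.1 (Hs_proj s phi u), fun u => F.2 (Hs_proj s phi u)).
Proof.
move=> cphi lin1 lin2; rewrite /reconstruction /decoder /encoder row_mxKl row_mxKr.
congr pair; apply/funext => u; have [c _ cu] := Hs_proj_span s u.
  have [_] := linear_on_lincomb C_space_lin_closed lin1 c cphi.
  rewrite cu => ->; apply: eq_bigr => m _.
  by rewrite mxE /estar -cu dual_basis_lincomb mulrC.
have [_] := linear_on_lincomb C_space_lin_closed lin2 c cphi.
rewrite cu => ->; apply: eq_bigr => m _.
by rewrite mxE /estar -cu dual_basis_lincomb mulrC.
Qed.

End dual_basis_theory.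

(** The error functional is [u |-> L (Pi u - u)] by linearity, so the bound [e]
    on the projection error is multiplied by the norm of [L]. *)
Lemma dual_Cr_norm_projection_error N (phi : 'I_N -> fn) (r : nat) (s e : R)
    (L : functional R d) :
  (forall m, C_space (phi m)) -> linear_on C_space L -> 0 < e ->
  (forall u, Cr_space r u -> (Cr_norm r u <= 1)%E ->
    (C_norm (fun x => u x - Hs_proj s phi u x)%R <= e%:E)%E) ->
  (dual_Cr_norm r (fun u => L (Hs_proj s phi u) - L u)%R <= e%:E * dual_C_norm L)%E.
Proof.
move=> cphi linL e0 proj_err; apply: ge_ereal_sup => _ [u [cru u1] <-].
have cu : C_space u by have [] := cru.
have cPu : C_space (Hs_proj s phi u).
  have [c _ <-] := Hs_proj_span phi s u.
  by have [] := linear_on_lincomb C_space_lin_closed linL c cphi.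
rewrite distrC -(linear_onB linL)//.
apply: le_dual_C_norm => //; last exact: proj_err.
have := C_space_lin_closed.2 (-1) _ _ cPu cu; congr C_space.
by apply/funext => x; rewrite mulN1r addrC.
Qed.

End reconstruction_error.

(** * Convergence rate *)

Theorem theorem1 (R : realType) (d k r : nat) (s t : R)
    (K : set (manifold_function R d k))
    (kappa : nat -> nat) (phi : forall n, 'I_(kappa n) -> 'rV[R]_d -> R) :
  (k <= d)%N -> compact K -> 0 <= s -> s <= r%:R ->
  convergence_sequence r s t phi ->
  bigO_rate t (fun n => sup_norm_on r K (fun p =>
    sub_pair (reconstruction s (phi n) (mf_embed p)) (mf_embed p))).
Proof.
move=> _ cK _ _ [_ _ phi_space phi_indep [C HC]].
have [B [B0 KB]] := compact_dual_C_norm2_bounded cK.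
(* Adding 1 makes the bound [e] below positive, as
   [dual_Cr_norm_projection_error] requires. *)
pose C' := `|C| + 1.
have C'0 : 0 < C' by rewrite ltr_wpDl.
exists (C' * B); apply: filterS2 HC (nbhs_infty_gt 0) => n HCn n0.
have nt0 : 0 < n%:R `^ t :> R by rewrite powR_gt0// ltr0n.
pose e := C' / n%:R `^ t.
have e0 : 0 < e by rewrite divr_gt0.
have phiC m : C_space (phi n m) by have [] := phi_space n m n0.
have proj_err u : Cr_space r u -> (Cr_norm r u <= 1)%E ->
    (C_norm (fun x => u x - Hs_proj s (phi n) u x)%R <= e%:E)%E.
  move=> cu u1; apply: (@le_trans _ _ (C / n%:R `^ t)%:E); last first.
    rewrite lee_fin ler_wpM2r ?invr_ge0 ?powR_ge0//.
    by rewrite (le_trans (ler_norm C))// lerDl.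
  apply: le_trans HCn.
  by apply: ereal_sup_ubound; exists u.
apply: ge_ereal_sup => _ [p Kp <-].
have [lin1 lin2] := mf_embed_linear p.
rewrite (reconstructionE (phi_indep n n0) s phiC lin1 lin2).
apply: (@le_trans _ _ (e%:E * dual_C_norm2 (mf_embed p))%E).
  rewrite /dual_C_norm2 ge0_muleDr ?dual_C_norm_ge0//.
  by apply: leeD; exact: dual_Cr_norm_projection_error.
apply: (@le_trans _ _ (e%:E * B%:E)%E).
  by rewrite lee_pmul2l ?lte_fin//; exact: KB.
by rewrite -EFinM lee_fin /e mulrAC.
Qed.
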